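(* Let $L\ge 1$ and consider an $(L+1)$-layer linear neural network with weight matrices $W_1(t),\dots,W_{L+1}(t)$ trained under the gradient flow $\dot W_i(t)=-\frac{\partial}{\partial W_i}\ell(W_1(t),\dots,W_{L+1}(t))$, $i\in\{1,\dots,L+1\}$, of the cross-entropy loss $\ell$ on $N$ training samples (as defined in the context). Let $\Pi(t)=W_L(t)W_{L-1}(t)\cdots W_1(t)$, and for $k\in\{1,\dots,d\}$ let $\sigma_k(t)$ be the $k$-th largest singular value of $\Pi(t)$. Assume: (1) the initial values of the weight matrices satisfy $W_{i+1}(0)^{\top}W_{i+1}(0)=W_i(0)W_i(0)^{\top}$ for every $i\in\{1,\dots,L-1\}$; (2) $|\mathbf{u}_k(t)^{\top}\mathbf{v}_{L+1,k'}(t)|=\mathbf{1}\{k=k'\}$ holds for all $t$, where $\mathbf{u}_k(t)$ is the $k$-th left singular vector of $\Pi(t)$ and $\mathbf{v}_{L+1,k'}(t)$ is the $k'$-th right singular vector of $W_{L+1}(t)$. Then $$\dot\sigma_k(t)=N\,L\,(\sigma_k(t))^{2-\frac{2}{L}}\sqrt{(\sigma_k(t))^{\frac{2}{L}}+M}\;\,(\mathbf{u}_{L+1,k}(t))^{\top}G(t)\,\mathbf{v}_k(t),$$ where $\mathbf{u}_{L+1,k}(t)$ is the $k$-th left singular vector of $W_{L+1}(t)$, $\mathbf{v}_k(t)$ is the $k$-th right singular vector of $\Pi(t)$, $M$ is a constant, and $$G(t)=\sum_{c=1}^{C}\mu_c\,(\mathbf{e}_c-\bar\gamma_c(t))\,\bar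 X_c^{\top}.$$
   Context: Data: $N$ training samples $X_1,\dots,X_N\in\mathbb{R}^{d_{\mathrm{in}}}$ with one-hot encoded labels $\mathbf{y}_1,\dots,\mathbf{y}_N\in\mathbb{R}^C$, where $C$ is the total number of classes; $\mathbf{e}_c$ denotes the $C$-dimensional one-hot vector whose $c$-th entry is $1$ and whose other entries are $0$. Network: a linear neural network (no nonlinear activations) with $L+1$ layers; $W_i(t)$ is the weight matrix of the $i$-th layer at optimization time $t$. The representation of sample $i$ is $\mathbf{z}_i(t)=W_L(t)\cdots W_1(t)X_i\in\mathbb{R}^d$, where $d$ is the representation dimension, and the output softmax probability vector is $\gamma_i(t)=\mathrm{softmax}(W_{L+1}(t)\mathbf{z}_i(t))=\mathrm{softmax}(W_{L+1}(t)W_L(t)\cdots W_1(t)X_i)\in\mathbb{R}^C$. Loss: the cross-entropy loss $\ell=\sum_{i=1}^N-\mathbf{y}_i^{\top}\log\gamma_i(t)$, with $\log$ applied entrywise. Gradient flow is gradient descent with an infinitesimally small learning rate; a dot denotes the derivative in $t$. Class statistics: $N_c$ is the number of samples belonging to class $c$ (that is, with $\mathbf{y}_i=\mathbf{e}_c$); $\mu_c=N_c/N$; $\bar\gamma_c(t)=\frac1{N_c}\sum_{i=1}^N\gamma_i(t)\mathbf{1}\{\mathbf{y}_i=\mathbf{e}_c\}$; $\bar X_c=\frac1{N_c}\sum_{i=1}^N X_i\mathbf{1}\{\mathbf{y}_i=\mathbf{e}_c\}$.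
   Formalization: The formula is proved at times when the pooled within-class cross-covariance of predictions and inputs vanishes (it fails otherwise), with u_k(t), v_k(t) continuous in t, the signs of W_{L+1}'s singular pairs fixed by u_k·v_{L+1,k} ≥ 0, and M constant in t but depending on k. *)

(* Defs.v *)
(* Written for MathComp-Analysis. *)
From HB Require Import structures.
From mathcomp Require Export all_boot all_order all_algebra.
From mathcomp Require Export all_classical all_reals all_analysis.
Export Order.TTheory GRing.Theory Num.Theory.
Export numFieldNormedType.Exports.

Set Implicit Arguments.
Unset Strict Implicit.
Unset Printing Implicit Defensive.

Local Open Scope classical_set_scope.
Local Open Scope ring_scope.

(* Layer widths are n 0 = d_in, n 1, ..., n L = d, n L.+1 = C.  Layers are
   numbered from 0, so W i is the matrix usually written W_{i+1}; only the
   matrices W 0, ..., W L are ever used. *)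
Definition weights (R : realType) (n : nat -> nat) : Type :=
  forall i : nat, 'M[R]_(n i.+1, n i).

(* W (k-1) *m ... *m W 0 *)
Fixpoint layer_prod (R : realType) (n : nat -> nat) (W : weights R n)
    (k : nat) : 'M[R]_(n k, n 0%N) :=
  if k is k'.+1 then W k' *m layer_prod W k' else 1%:M.

Definition onehot (R : realType) (C : nat) (c : 'I_C) : 'cV[R]_C :=
  delta_mx c 0.

Definition softmax (R : realType) (C : nat) (z : 'cV[R]_C) : 'cV[R]_C :=
  \col_c (expR (z c 0) / \sum_j expR (z j 0)).

Section Network.
Variables (R : realType) (n : nat -> nat) (L N : nat).
Variables (X : 'I_N -> 'cV[R]_(n 0%N)) (lab : 'I_N -> 'I_(n L.+1)).
Implicit Types (W : weights R n) (i : 'I_N) (c : 'I_(n L.+1)).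

Definition prob W i : 'cV[R]_(n L.+1) := softmax (layer_prod W L.+1 *m X i).

Definition loss W : R :=
  \sum_i - ((onehot R (lab i))^T *m map_mx (@ln R) (prob W i)) 0 0.

(* The matrix of partial derivatives of the loss with respect to the entries
   of W j, all the other weight matrices being held fixed. *)
Definition grad W (j : nat) : 'M[R]_(n j.+1, n j) :=
  \matrix_(a, b)
    'D_(delta_mx a b)
      (fun A : 'M[R]_(n j.+1, n j) =>
         loss (@dfwith nat (fun l => 'M[R]_(n l.+1, n l)) W j A)) (W j).

Definition class_size c : nat := #|[pred i | lab i == c]|.

(* For an empty class the two means below are 0, since 0^-1 = 0. *)
Definition class_mean_prob W c : 'cV[R]_(n L.+1) :=
  (class_size c)%:R^-1 *: \sum_(i | lab i == c) prob W i.

Definition class_mean_input c : 'cV[R]_(n 0%N) :=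
  (class_size c)%:R^-1 *: \sum_(i | lab i == c) X i.

Definition Gmat W : 'M[R]_(n L.+1, n 0%N) :=
  \sum_c ((class_size c)%:R / N%:R) *:
    ((onehot R c - class_mean_prob W c) *m (class_mean_input c)^T).

(* Pooled within-class cross-covariance of predictions and inputs.  The
   gradient of the loss with respect to the end-to-end matrix is
   - N *: Gmat W + within_class_cov W, so it is expressed by the class means
   alone exactly when this matrix vanishes. *)
Definition within_class_cov W : 'M[R]_(n L.+1, n 0%N) :=
  \sum_i (prob W i - class_mean_prob W (lab i))
         *m (X i - class_mean_input (lab i))^T.

End Network.

(* f has derivative l at t, for f a function on the half line [0, +oo[: the
   two-sided derivative if 0 < t, the right derivative if t = 0. *)
Definition has_deriv_ge0 (R : realType) (E : normedModType R) (f : R -> E)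
    (t : R) (l : E) : Prop :=
  (s - t)^-1 *: (f s - f t) @[s --> within [set s : R | 0 <= s] t^'] --> l.

(* Full singular value decomposition A = U *m Sigma *m V^T, with U and V
   orthogonal and Sigma rectangular diagonal.  The singular values s 0 >= s 1
   >= ... are numbered from 0 and continued by 0 beyond minn m n. *)
Definition is_svd (R : realType) (m n : nat) (A : 'M[R]_(m, n))
    (U : 'M[R]_m) (s : nat -> R) (V : 'M[R]_n) : Prop :=
  [/\ U^T *m U = 1%:M,
      V^T *m V = 1%:M,
      A = U *m (\matrix_(i < m, j < n) (s i *+ (i == j :> nat))) *m V^T,
      (forall i j : nat, (i <= j)%N -> 0 <= s j <= s i) &
      (forall i : nat, (minn m n <= i)%N -> s i = 0)].

(* The k-th column of A, or 0 when k >= n: with k < d = n L this gives a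
   meaning to v_k when d > d_in and to u_{L+1,k} when d > C. *)
Definition nth_col (R : realType) (m n : nat) (A : 'M[R]_(m, n)) (k : nat) :
    'cV[R]_m :=
  oapp (fun j : 'I_n => col j A) 0 (insub k).

(* Main.v *)
Require Import Defs.
From mathcomp Require Import ring lra zify.

(* Gradient flow conserves W_{i+1}^T W_{i+1} - W_i W_i^T.  For the hidden
   layers this difference is 0, so with S = W_L W_L^T one gets
   Pi Pi^T = S^L, hence S u_k = sigma_k^(2/L) u_k by uniqueness of positive
   semidefinite roots.  For the last pair the difference is a constant
   symmetric matrix Q, and alignment makes u_k(t) an eigenvector of Q with
   eigenvalue M(t) = s_k(t)^2 - sigma_k(t)^(2/L), where s_k is the singular
   value of the output layer.  Eigenvectors of Q for distinct eigenvalues are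
   orthogonal, so continuity of u_k forces M to be constant.  Finally
   d(sigma_k)/dt = u_k^T (dPi/dt) v_k, and each of the L terms of dPi/dt given
   by the product rule contributes
   N sigma_k^(2-2/L) s_k u_{L+1,k}^T G v_k. *)

Set Implicit Arguments.
Unset Strict Implicit.
Unset Printing Implicit Defensive.

Local Open Scope classical_set_scope.
Local Open Scope ring_scope.

(** * Powers of Gram matrices *)

Section MatrixPowers.
Variable R : comNzRingType.

Lemma trmx_exp m (S : 'M[R]_m) k : (S ^+ k)^T = S^T ^+ k.
Proof.
elim: k => [|k IH]; first by rewrite !expr0 trmx1.
by rewrite exprSr exprS -!mulmxE trmx_mul IH.
Qed.

Lemma gram_expS p q (A : 'M[R]_(p, q)) k :
  A *m (A^T *m A) ^+ k *m A^T = (A *m A^T) ^+ k.+1.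
Proof.
elim: k => [|k IH]; first by rewrite expr0 mulmx1 expr1.
by rewrite exprS -mulmxE exprS -mulmxE -IH !mulmxA.
Qed.

Lemma eigen_pow m (S : 'M[R]_m) (u : 'cV[R]_m) r k :
  S *m u = r *: u -> S ^+ k *m u = r ^+ k *: u.
Proof.
move=> Su; elim: k => [|k IH]; first by rewrite !expr0 mul1mx scale1r.
by rewrite exprSr -mulmxE -mulmxA Su -scalemxAr IH scalerA -exprS.
Qed.

End MatrixPowers.

Section SymmetricPowers.
Variables (R : realFieldType) (m : nat).
Implicit Types (S : 'M[R]_m) (u w : 'cV[R]_m).

Lemma dot_sum p (w : 'cV[R]_p) : (w^T *m w) 0 0 = \sum_i w i 0 ^+ 2.
Proof. by rewrite mxE; apply: eq_bigr => i _; rewrite mxE expr2. Qed.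

Lemma dot_ge0 p (w : 'cV[R]_p) : 0 <= (w^T *m w) 0 0.
Proof. by rewrite dot_sum sumr_ge0 // => i _; exact: sqr_ge0. Qed.

Lemma dot_eq0 p (w : 'cV[R]_p) : (w^T *m w) 0 0 = 0 -> w = 0.
Proof.
rewrite dot_sum => /psumr_eq0P w0; apply/matrixP => i j.
rewrite ord1 mxE; apply/eqP; rewrite -sqrf_eq0; apply/eqP/w0 => // l _.
exact: sqr_ge0.
Qed.

(** With S = B B^T, the value is |S^h w|^2 for k = 2h and |B^T S^h w|^2 for k = 2h+1. *)
Lemma gram_pow_ge0 p (B : 'M[R]_(m, p)) w k :
  0 <= (w^T *m (B *m B^T) ^+ k *m w) 0 0.
Proof.
have symS : (B *m B^T)^T = B *m B^T by rewrite trmx_mul trmxK.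
rewrite -(odd_double_half k) exprD -addnn.
set S := B *m B^T; set h := k./2.
have -> : w^T *m (S ^+ odd k * S ^+ (h + h)) *m w =
    (S ^+ h *m w)^T *m S ^+ odd k *m (S ^+ h *m w).
  rewrite trmx_mul trmx_exp symS -/S -!mulmxA; congr (_ *m _).
  rewrite !mulmxA !mulmxE -!exprD.
  by congr (_ ^+ _ *m _); lia.
case: (odd k) => /=; rewrite ?expr0 ?mulmx1; last exact: dot_ge0.
move: (S ^+ h *m w) => x; rewrite expr1.
have -> : x^T *m S *m x = (B^T *m x)^T *m (B^T *m x).
  by rewrite trmx_mul trmxK !mulmxA.
exact: dot_ge0.
Qed.

(** By symmetry |S^(k+1) u|^2 = <u, S^k S^(k+2) u>, so the exponent can be lowered one unit at a
    time. *)
Lemma sym_pow_eq0 S u k : S^T = S -> S ^+ k.+1 *m u = 0 -> S *m u = 0.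
Proof.
move=> symS; elim: k => [|k IH]; first by rewrite expr1.
move=> Su0; apply: IH; apply: dot_eq0.
rewrite trmx_mul trmx_exp symS -mulmxA (mulmxA _ _ u) mulmxE -exprD.
have -> : (k.+1 + k.+1 = k + k.+2)%N by lia.
by rewrite exprD -mulmxE -(mulmxA _ _ u) Su0 !mulmx0 mxE.
Qed.

(* Uniqueness of the positive semidefinite L-th root, read on one eigenvector:
   with w = (S - r) u, the sum of the r^(L-1-i) <w, S^i w> vanishes while each
   of its terms is nonnegative. *)
Lemma gram_pow_eigen p (B : 'M[R]_(m, p)) u (r : R) k : 0 <= r ->
  (B *m B^T) ^+ k.+1 *m u = r ^+ k.+1 *: u -> (B *m B^T) *m u = r *: u.
Proof.
have symS : (B *m B^T)^T = B *m B^T by rewrite trmx_mul trmxK.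
rewrite le_eqVlt => /predU1P[<-|r0].
  (* The case r = 0 is treated apart, because the weight r^k divided out below may vanish. *)
  by rewrite expr0n /= !scale0r; exact: sym_pow_eq0.
move=> Su; apply/eqP; rewrite -subr_eq0; apply/eqP.
set S := B *m B^T in symS Su *.
set w := _ - _.
have key : \sum_(i < k.+1) r ^+ (k - i) * (w^T *m S ^+ i *m w) 0 0 = 0.
  have wE : w = (S - r%:M) *m u by rewrite mulmxBl mul_scalar_mx.
  have : w^T *m ((S ^+ k.+1 - (r%:M) ^+ k.+1) *m u) = 0.
    rewrite mulmxBl Su -mul_scalar_mx.
    have -> : (r%:M ^+ k.+1 : 'M[R]_m) = (r ^+ k.+1)%:M.
      by elim: k.+1 => [|l IH] //; rewrite !exprS IH -mulmxE -scalar_mxM.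
    by rewrite subrr mulmx0.
  have cSr : GRing.comm S r%:M by rewrite /GRing.comm -!mulmxE scalar_mxC.
  rewrite (subrXX_comm _ cSr) => /matrixP/(_ 0 0); rewrite [RHS]mxE => e0.
  rewrite -[RHS]e0.
  (* Commuting [S - r%:M] to the right lets it act on [u] and produce the second [w]. *)
  have -> : (S - r%:M) * (\sum_(i < k.+1) S ^+ (k.+1.-1 - i) * r%:M ^+ i)
     = (\sum_(i < k.+1) S ^+ (k.+1.-1 - i) * r%:M ^+ i) * (S - r%:M).
    have cS : GRing.comm (S - r%:M) S.
      by apply/commr_sym/commrB => //; exact: commr_refl.
    have cr : GRing.comm (S - r%:M) r%:M.
      by apply/commr_sym/commrB; [exact: commr_sym|exact: commr_refl].
    by apply: commr_sum => i _; apply: commrM; exact: commrX.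
  rewrite -mulmxE -(mulmxA _ _ u) -wE mulmx_suml mulmx_sumr summxE.
  rewrite (reindex_inj rev_ord_inj) /=; apply: eq_bigr => i _.
  have -> : (r%:M ^+ i : 'M[R]_m) = (r ^+ i)%:M.
    by elim: (val i) => [|l IH] //; rewrite !exprS IH -mulmxE -scalar_mxM.
  rewrite mul_mx_scalar -scalemxAl -scalemxAr mulmxA [RHS]mxE.
  by rewrite subSS subKn // -ltnS.
have term_ge0 i : 0 <= r ^+ (k - i) * (w^T *m S ^+ i *m w) 0 0.
  by rewrite mulr_ge0 ?gram_pow_ge0 // exprn_ge0 // ltW.
(* The term of index 0 is r^k |w|^2 with r^k > 0, so its vanishing forces w = 0. *)
apply: dot_eq0; have /psumr_eq0P/(_ 0 isT) := key.
rewrite subn0 expr0 mulmx1 => /(_ _)/eqP; rewrite mulf_eq0 expf_eq0.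
by rewrite (gt_eqF r0) andbF /= => /(_ (fun i _ => term_ge0 i))/eqP.
Qed.

End SymmetricPowers.

(** * Products of consecutive layers *)

Section TailProd.
Variables (R : realType) (n : nat -> nat).
Implicit Types (W : weights R n).

(* W (m-1) *m ... *m W j for j <= m; conform_mx only casts the identity. *)
Fixpoint tail_prod W (j m : nat) : 'M[R]_(n m, n j) :=
  match m return 'M[R]_(n m, n j) with
  | 0 => conform_mx 0 (1%:M : 'M[R]_(n j))
  | m'.+1 => if j == m'.+1 then conform_mx 0 (1%:M : 'M[R]_(n j))
             else W m' *m tail_prod W j m'
  end.

Lemma tail_prod_id W j : tail_prod W j j = 1%:M.
Proof. by case: j => [|j] /=; rewrite ?eqxx conform_mx_id. Qed.

Lemma tail_prodS W j m :
  (j <= m)%N -> tail_prod W j m.+1 = W m *m tail_prod W j m.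
Proof. by move=> jm /=; rewrite ltn_eqF // ltnS. Qed.

(** The recursion of [tail_prod] peels off the leftmost factor; comparing the gradients of
    consecutive layers requires the rightmost one. *)
Lemma tail_prod_recr W j m : (j < m)%N ->
  tail_prod W j m = tail_prod W j.+1 m *m W j.
Proof.
elim: m => // m IH; rewrite ltnS leq_eqVlt => /predU1P[<-|jm].
  by rewrite tail_prodS // !tail_prod_id mulmx1 mul1mx.
by rewrite (tail_prodS _ jm) (tail_prodS _ (ltnW jm)) -mulmxA IH.
Qed.

Lemma layer_prod_tail W j m : (j <= m)%N ->
  layer_prod W m = tail_prod W j m *m layer_prod W j.
Proof.
elim: m => [|m IH].
  by rewrite leqn0 => /eqP->; rewrite tail_prod_id mul1mx.
rewrite leq_eqVlt => /predU1P[->|jm]; first by rewrite tail_prod_id mul1mx.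
by rewrite tail_prodS // -mulmxA -IH.
Qed.

Lemma eq_layer_prod W W' m : (forall i, (i < m)%N -> W i = W' i) ->
  layer_prod W m = layer_prod W' m.
Proof.
elim: m => //= m IH eW; rewrite eW // IH // => i im; apply: eW.
exact: ltnW.
Qed.

Lemma eq_tail_prod W W' j m : (forall i, (j <= i < m)%N -> W i = W' i) ->
  (j <= m)%N -> tail_prod W j m = tail_prod W' j m.
Proof.
elim: m => [|m IH] eW; first by rewrite leqn0 => /eqP->.
rewrite leq_eqVlt => /predU1P[->|jm]; first by rewrite !tail_prod_id.
rewrite !tail_prodS // IH ?eW //; first by rewrite -ltnS jm /=.
by move=> i /andP[ji im]; rewrite eW // ji ltnW.
Qed.

(** The factors on either side of layer j do not see the replacement, so the network is linear in
    the replaced matrix. *)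
Lemma layer_prod_dfwith W j (A : 'M[R]_(n j.+1, n j)) m : (j < m)%N ->
  layer_prod (@dfwith nat (fun l => 'M[R]_(n l.+1, n l)) W j A) m
  = tail_prod W j.+1 m *m A *m layer_prod W j.
Proof.
move=> jm; rewrite (layer_prod_tail _ jm) /= dfwithin mulmxA.
congr (_ *m _ *m _).
- apply: eq_tail_prod => // i /andP[ji _]; rewrite dfwithout //.
  by rewrite ltn_eqF.
- by apply: eq_layer_prod => i ij; rewrite dfwithout // gtn_eqF.
Qed.

Section Balanced.
Variables (W : weights R n) (L : nat).
Hypothesis bal : forall i, (i.+1 < L)%N ->
  (W i.+1)^T *m W i.+1 = W i *m (W i)^T.

(** Induction on m: balance turns the inner power of W_m W_m^T into a power of W_{m+1}^T W_{m+1},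
    and [gram_expS] absorbs the outer factors. *)
Lemma tail_prod_gram j m : (m < L)%N -> (j <= m.+1)%N ->
  tail_prod W j m.+1 *m (tail_prod W j m.+1)^T = (W m *m (W m)^T) ^+ (m.+1 - j).
Proof.
elim: m => [|m IH] mL.
  case: j => [|[|//]] _; last by rewrite tail_prod_id trmx1 mulmx1.
  by rewrite tail_prodS // tail_prod_id mulmx1.
rewrite leq_eqVlt => /predU1P[->|jm].
  by rewrite tail_prod_id trmx1 mulmx1 subnn.
have IH1 := IH (ltnW mL) jm.
rewrite tail_prodS // trmx_mul !mulmxA -(mulmxA (W m.+1)) IH1.
by rewrite -bal // gram_expS (@subSn j m.+1).
Qed.

Lemma layer_prod_gram m : (m <= L)%N ->
  (layer_prod W m)^T *m layer_prod W m = ((W 0%N)^T *m W 0%N) ^+ m.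
Proof.
elim: m => [|m IH] mL; first by rewrite /= trmx1 mulmx1 expr0.
(* Balance slides the Gram matrix down one layer at a time until it reaches the input layer. *)
have WB : (W m)^T *m W m *m layer_prod W m
    = layer_prod W m *m ((W 0%N)^T *m W 0%N).
  elim: m mL {IH} => [|m IH] mL; first by rewrite mulmx1 mul1mx.
  by rewrite bal //= -!mulmxA; congr (_ *m _); rewrite mulmxA IH // ltnW.
rewrite [layer_prod W m.+1]/= trmx_mul -mulmxA.
by rewrite (mulmxA _ (W m)) WB mulmxA IH 1?ltnW // mulmxE -exprSr.
Qed.

End Balanced.
End TailProd.

(** * Gradient of the loss *)

Section LossGradient.
Variable R : realType.

Lemma is_derive_affine (a b x : R) :
  is_derive x 1 (fun h : R => a + h * b) b.
Proof.
have -> : (fun h : R => a + h * b) = cst a + (fun h : R => h * b) by [].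
have := is_deriveD (is_derive_cst a x 1)
  (is_deriveM (is_derive_id x 1) (is_derive_cst b x 1)).
by move/is_derive_eq; apply; rewrite scaler0 !add0r /GRing.scale /= mulr1.
Qed.

(** The logarithm of softmax is a coordinate minus log-sum-exp, whose derivative along w is the
    softmax average of w. *)
Lemma is_derive_log_softmax C (z w : 'cV[R]_C) (c : 'I_C) :
  is_derive (0 : R) 1 (fun h : R => ln (softmax (z + h *: w) c 0))
    (w c 0 - \sum_j softmax z j 0 * w j 0).
Proof.
pose e j (h : R) := expR (z j 0 + h * w j 0).
pose S (h : R) := \sum_j e j h.
have S_gt0 h : 0 < S h.
  rewrite /S (bigD1 c) //= ltr_wpDr ?expR_gt0 // sumr_ge0 // => j _.
  exact: expR_ge0.
have -> : (fun h : R => ln (softmax (z + h *: w) c 0))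
    = (fun h : R => z c 0 + h * w c 0) - (@ln R \o S).
  apply/funext => h; rewrite mxE.
  have -> : \sum_j expR ((z + h *: w) j 0) = S h.
    by apply: eq_bigr => j _; rewrite !mxE.
  by rewrite ln_div ?posrE ?expR_gt0 // expRK !mxE.
have dS : is_derive (0 : R) 1 S (\sum_j e j 0 * w j 0).
  have -> : S = \sum_j e j by apply/funext => h; rewrite fct_sumE.
  apply: is_derive_sum => j.
  apply: (@is_derive1_comp _ expR (fun h => z j 0 + h * w j 0)).
  exact: is_derive_affine.
have dln := is_derive1_comp (is_derive1_ln (S_gt0 0)) dS.
have := is_deriveB (is_derive_affine (z c 0) (w c 0) 0) dln.
move/is_derive_eq; apply; congr (_ - _).
rewrite mulr_sumr; apply: eq_bigr => j _.
rewrite mxE mulrA [_^-1 * _]mulrC /e mul0r addr0; congr (_ / _ * _).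
by apply: eq_bigr => i _; rewrite /e mul0r addr0.
Qed.

Variables (n : nat -> nat) (L N : nat).
Variables (X : 'I_N -> 'cV[R]_(n 0%N)) (lab : 'I_N -> 'I_(n L.+1)).

(** This is the gradient of the loss with respect to the end-to-end matrix. *)
Definition output_grad (W : weights R n) : 'M[R]_(n L.+1, n 0%N) :=
  \sum_i (prob L X W i - onehot R (lab i)) *m (X i)^T.

Lemma lossE (W : weights R n) :
  loss X lab W = \sum_i - ln (prob L X W i (lab i) 0).
Proof.
apply: eq_bigr => i _; congr (- _).
rewrite mxE (bigD1 (lab i)) //= big1 ?addr0 => [|j ji].
  by rewrite !mxE !eqxx mul1r.
by rewrite !mxE (negbTE ji) mul0r.
Qed.

(** Chain rule: moving entry (a, b) of layer j moves the logits of sample i along the line z_i + h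
    w_i, where the derivative of log-softmax is known. *)
Lemma gradE (W : weights R n) j : (j <= L)%N ->
  grad X lab W j =
    (tail_prod W j.+1 L.+1)^T *m output_grad W *m (layer_prod W j)^T.
Proof.
move=> jL; apply/matrixP => a b; rewrite mxE.
set T := tail_prod W j.+1 L.+1; set B := layer_prod W j.
pose w i := T *m delta_mx a b *m B *m X i.
pose z i := layer_prod W L.+1 *m X i.
pose phi := \sum_i (- (fun h : R => ln (softmax (z i + h *: w i) (lab i) 0))).
have dphi : is_derive (0 : R) 1 phi
    (\sum_i - (w i (lab i) 0 - \sum_c softmax (z i) c 0 * w i c 0)).
  by apply: is_derive_sum => i; apply: is_deriveN; exact: is_derive_log_softmax.
set f := (fun A : 'M[R]_(n j.+1, n j) => _).
have fE h : f (h *: delta_mx a b + W j) = phi h.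
  rewrite /f lossE /phi fct_sumE; apply: eq_bigr => i _.
  congr (- ln (softmax _ _ _)); rewrite layer_prod_dfwith // -/T -/B.
  rewrite /z /w (layer_prod_tail W (j := j.+1) (m := L.+1)) // -/T /= -/B.
  by rewrite mulmxDr !mulmxDl addrC -scalemxAr -!scalemxAl !mulmxA.
(* The matrix directional derivative and the scalar derivative of [phi] at 0 have the same
   difference quotient. *)
have -> : 'D_(delta_mx a b) f (W j) = 'D_1 phi 0.
  rewrite /derive; congr (lim (_ @[h --> 0^'])).
  apply/funext => h /=; rewrite fE -[in f (W j)](add0r (W j)).
  by rewrite -(scale0r (delta_mx a b)) fE addr0 /GRing.scale /= mulr1.
rewrite (@derive_val _ _ _ _ _ _ _ dphi).
rewrite /output_grad mulmx_sumr mulmx_suml summxE; apply: eq_bigr => i _.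
rewrite opprB -!mulmxA -trmx_mul mulmxA.
transitivity (((prob L X W i - onehot R (lab i))^T *m w i) 0 0).
  rewrite linearB /= mulmxBl; move: (w i) => v; rewrite mxE; congr (_ + _).
    by rewrite [RHS]mxE; apply: eq_bigr => c _; rewrite [in RHS]mxE.
  rewrite !mxE (bigD1 (lab i)) //= big1 ?addr0 => [|c ci].
    by rewrite !mxE !eqxx mul1r.
  by rewrite !mxE (negbTE ci) mul0r.
rewrite /w; set q := _ - _; set x := B *m X i.
(* Since the elementary matrix is e_a e_b^T, the scalar splits into a product of two vector
   entries. *)
have -> : q^T *m (T *m delta_mx a b *m B *m X i)
    = (T^T *m q)^T *m delta_mx a (0 : 'I_1) *m (delta_mx (0 : 'I_1) b *m x).
  by rewrite trmx_mul trmxK mulmxA -(mulmxA _ _ (_ *m x)) [_ *m (_ *m x)]mulmxA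
    mul_delta_mx /x !mulmxA.
rewrite -colE -rowE; move: (T^T *m q) x => y {}x.
by rewrite !mxE !big_ord1 !mxE.
Qed.

(** The three correction terms of the expanded product sum to m - m - m times the product of the
    means. Stating the means through [m *: gbar], without division, covers an empty class. *)
Lemma sum_centered_mul p q (P : pred 'I_N) (g : 'I_N -> 'cV[R]_p)
    (x : 'I_N -> 'cV[R]_q) (m : R) gbar xbar :
  \sum_(i | P i) g i = m *: gbar -> \sum_(i | P i) x i = m *: xbar ->
  m = #|P|%:R ->
  \sum_(i | P i) (g i - gbar) *m (x i - xbar)^T =
    \sum_(i | P i) g i *m (x i)^T - m *: (gbar *m xbar^T).
Proof.
move=> gE xE mE.
rewrite (eq_bigr (fun i => g i *m (x i)^T +
    (gbar *m xbar^T - g i *m xbar^T - gbar *m (x i)^T))); last first.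
  move=> i _; rewrite linearB /= mulmxBl !mulmxBr opprB addrA addrAC.
  by rewrite -!addrA; congr (_ + _); rewrite !addrA addrC addrA.
have xTE : \sum_(i | P i) (x i)^T = m *: xbar^T.
  by rewrite -linearZ -xE linear_sum.
have cE : \sum_(i | P i) gbar *m xbar^T = m *: (gbar *m xbar^T).
  by rewrite mE scaler_nat -sumr_const; apply: eq_bigl.
rewrite big_split /= !sumrB cE -mulmx_suml -mulmx_sumr gE xTE.
by rewrite -scalemxAl -scalemxAr subrr sub0r.
Qed.

(** Samples are grouped by class. The label is constant on a class, so its part involves only the
    class mean of the inputs; the prediction part is a covariance plus a product of means. *)
Lemma output_gradE (W : weights R n) :
  output_grad W = within_class_cov X lab W - N%:R *: Gmat X lab W.
Proof.
rewrite /output_grad /within_class_cov /Gmat scaler_sumr.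
rewrite (partition_big lab xpredT) //= [in RHS](partition_big lab xpredT) //=.
rewrite -sumrB; apply: eq_bigr => c _.
set m : R := (class_size lab c)%:R.
have mE : m = #|[pred i | lab i == c]|%:R by [].
have sumE p (g : 'I_N -> 'cV[R]_p) :
    \sum_(i | lab i == c) g i = m *: (m^-1 *: \sum_(i | lab i == c) g i).
  have [m0|m0] := eqVneq m 0; last by rewrite scalerA divff // scale1r.
  rewrite m0 scale0r big1 // => i lic; move/eqP: m0.
  by rewrite mE pnatr_eq0 => /eqP/card0_eq e0; move: (e0 i); rewrite inE lic.
rewrite scalerA.
(* If N = 0 the quotient is 0 by convention, but then every class size is 0 as well. *)
have -> : N%:R * (m / N%:R) = m.
  have [N0|N0] := eqVneq (N%:R : R) 0; last by rewrite mulrC divfK.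
  rewrite N0 mul0r /m; apply/esym/eqP; rewrite pnatr_eq0 -leqn0.
  have/eqP := N0; rewrite pnatr_eq0 => /eqP <-.
  by rewrite -[X in (_ <= X)%N](card_ord N) max_card.
transitivity (\sum_(i | lab i == c) prob L X W i *m (X i)^T
    - onehot R c *m (m *: class_mean_input X lab c)^T).
  rewrite /class_mean_input -sumE linear_sum mulmx_sumr -sumrB.
  by apply: eq_bigr => i /eqP->; rewrite mulmxBl.
rewrite [X in _ = X - _](eq_bigr (fun i =>
    (prob L X W i - class_mean_prob X lab W c)
    *m (X i - class_mean_input X lab c)^T)); last by move=> i /eqP->.
rewrite (sum_centered_mul (sumE _ _) (sumE _ _) mE).
rewrite mulmxBl scalerBr opprB addrA; congr (_ - _).
  by rewrite subrK.
by rewrite linearZ /= -scalemxAr.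
Qed.

End LossGradient.

(** * Derivatives on the half line *)

Section MatrixLimits.
Variables (R : realType) (T : Type) (F : set_system T).
Context {FF : Filter F}.

Lemma cvg_mxP m n (f : T -> 'M[R]_(m, n)) (M : 'M[R]_(m, n)) :
  f @ F --> M <-> forall i j, f x i j @[x --> F] --> M i j.
Proof.
split=> [fM i j|fM].
  exact: (cvg_comp _ _ fM (@coord_continuous R m n i j M)).
move=> A [P PM PA]; rewrite /= /nbhs /=.
have : F (fun x => forall i j, P i j (f x i j)).
  apply: filter_forall => i; apply: filter_forall => j.
  exact: fM (PM i j).
by apply: filterS => x Px; exact: PA.
Qed.

Lemma cvg_mulmx m n p (f : T -> 'M[R]_(m, n)) (g : T -> 'M[R]_(n, p))
    (A : 'M[R]_(m, n)) (B : 'M[R]_(n, p)) :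
  f @ F --> A -> g @ F --> B -> f x *m g x @[x --> F] --> A *m B.
Proof.
move=> /cvg_mxP fA /cvg_mxP gB; apply/cvg_mxP => i j.
under eq_fun do rewrite mxE.
rewrite mxE; apply: cvg_big => [|k _]; last by apply: cvgM.
exact: add_continuous.
Qed.

Lemma cvg_trmx m n (f : T -> 'M[R]_(m, n)) (A : 'M[R]_(m, n)) :
  f @ F --> A -> (f x)^T @[x --> F] --> A^T.
Proof.
move=> /cvg_mxP fA; apply/cvg_mxP => i j.
by under eq_fun do rewrite mxE; rewrite mxE; exact: fA.
Qed.

End MatrixLimits.

Section HalfLineDerivative.
Variable R : realType.

Local Notation half t := (within [set s : R | 0 <= s] t^').

Lemma near_half (t : R) : \forall s \near half t, s != t /\ 0 <= s.
Proof. by apply: (@filterE _ (nbhs t)) => s st s0. Qed.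

Lemma cvg_half_id (t : R) : s @[s --> half t] --> t.
Proof.
by apply: cvg_within_filter; apply: cvg_within_filter; exact: cvg_id.
Qed.

Lemma has_deriv_ge0_cvg (E : normedModType R) (f : R -> E) t l :
  has_deriv_ge0 f t l -> f s @[s --> half t] --> f t.
Proof.
move=> ft; rewrite -[X in _ --> X]add0r -(scale0r l).
have st : s - t @[s --> half t] --> (0 : R).
  rewrite -[X in _ --> X](subrr t); apply: cvgB; last exact: cvg_cst.
  exact: cvg_half_id.
have : ((s - t) *: ((s - t)^-1 *: (f s - f t)) + f t) @[s --> half t]
    --> 0 *: l + f t by apply: cvgD; [exact: cvgZ|exact: cvg_cst].
apply: cvg_trans; apply: near_eq_cvg.
apply: filterS (near_half t) => s [st0 _] /=.
by rewrite scalerA divff ?subr_eq0 // scale1r subrK.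
Qed.

Lemma has_deriv_ge0_cst (E : normedModType R) (c : E) t :
  has_deriv_ge0 (fun=> c) t 0.
Proof.
rewrite /has_deriv_ge0; under eq_fun do rewrite subrr scaler0.
exact: cvg_cst.
Qed.

Lemma has_deriv_ge0B (E : normedModType R) (f g : R -> E) t l k :
  has_deriv_ge0 f t l -> has_deriv_ge0 g t k ->
  has_deriv_ge0 (fun s => f s - g s) t (l - k).
Proof.
move=> ft gt.
have : ((s - t)^-1 *: (f s - f t) - (s - t)^-1 *: (g s - g t))
    @[s --> half t] --> l - k by exact: cvgB.
apply: cvg_trans; apply: near_eq_cvg.
apply: filterS (near_half t) => s _ /=.
by rewrite -scalerBr; congr (_ *: _); rewrite !opprD !opprK addrACA.
Qed.

Lemma has_deriv_ge0_mulmx m n p (A : R -> 'M[R]_(m, n)) (B : R -> 'M[R]_(n, p))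
    t (dA : 'M[R]_(m, n)) (dB : 'M[R]_(n, p)) :
  has_deriv_ge0 A t dA -> has_deriv_ge0 B t dB ->
  has_deriv_ge0 (fun s => A s *m B s) t (dA *m B t + A t *m dB).
Proof.
move=> At Bt.
have : ((s - t)^-1 *: (A s - A t) *m B s + A t *m ((s - t)^-1 *: (B s - B t)))
    @[s --> half t] --> dA *m B t + A t *m dB.
  apply: cvgD; first exact: cvg_mulmx At (has_deriv_ge0_cvg Bt).
  by apply: cvg_mulmx Bt; exact: cvg_cst.
apply: cvg_trans; apply: near_eq_cvg; apply: filterS (near_half t) => s _ /=.
rewrite -scalemxAl -scalemxAr -scalerDr mulmxBl mulmxBr.
by rewrite addrA subrK.
Qed.

Lemma has_deriv_ge0_trmx m n (A : R -> 'M[R]_(m, n)) t (dA : 'M[R]_(m, n)) :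
  has_deriv_ge0 A t dA -> has_deriv_ge0 (fun s => (A s)^T) t dA^T.
Proof.
move=> /cvg_trmx; apply: cvg_trans; apply: near_eq_cvg.
by apply: filterS (near_half t) => s _; rewrite linearZ /= linearB.
Qed.

Lemma has_deriv_ge0_entry m n (A : R -> 'M[R]_(m, n)) t (dA : 'M[R]_(m, n))
    i j :
  has_deriv_ge0 A t dA -> has_deriv_ge0 (fun s => A s i j) t (dA i j).
Proof.
move=> /cvg_mxP/(_ i j); apply: cvg_trans; apply: near_eq_cvg.
by apply: filterS (near_half t) => s _; rewrite !mxE.
Qed.

(** Near t > 0 the half-line restriction is void; this gives access to the mean value theorem. *)
Lemma has_deriv_ge0_is_derive (f : R -> R) t l : 0 < t ->
  has_deriv_ge0 f t l -> is_derive t 1 f l.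
Proof.
move=> t0 ft.
have pos : \forall s \near t, 0 <= s by exact: lt_le_nbhsr.
have ft' : (s - t)^-1 *: (f s - f t) @[s --> t^'] --> l.
  apply: cvg_trans ft; apply: cvg_app => A At.
  have pos' : \forall s \near t^', 0 <= s by exact: nbhs_dnbhs.
  exact: (@filterS2 _ t^' _ _ _ _ (fun s s0 sA => sA s0) pos' At).
have qt : h^-1 *: ((f \o shift t) (h *: 1) - f t) @[h --> 0^'] --> l.
  have sh : t + h @[h --> (0 : R)^'] --> t^'.
    move=> A; rewrite /dnbhs /within /= => At.
    have {}At : \forall y \near t, y != t -> A y by [].
    rewrite (near_shift 0) in At; apply: filterS At => h /= + h0.
    by rewrite subr0 addrC; apply; rewrite -subr_eq0 addrAC subrr add0r.
  have := cvg_comp _ _ sh ft'; apply: cvg_trans; apply: near_eq_cvg.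
  apply: nearW => h /=.
  have -> : h%:A + t = t + h by rewrite /GRing.scale /= mulr1 addrC.
  by congr (_^-1 *: _); rewrite addrAC subrr add0r.
split; first by apply/cvg_ex; exists l.
exact: cvg_lim.
Qed.

Lemma deriv_ge0_0_cst (f : R -> R) :
  (forall t, 0 <= t -> has_deriv_ge0 f t 0) -> forall t, 0 <= t -> f t = f 0.
Proof.
move=> f0 t t0.
have fd x : x \in `]0, t[ -> is_derive x 1 f 0.
  rewrite in_itv => /andP[x0 _]; apply: has_deriv_ge0_is_derive => //.
  exact/f0/ltW.
(* Continuity at both endpoints comes from the half-line limits, whose filter allows every approach
   inside [0, t]. *)
have fc : {within `[0, t], continuous f}.
  apply/subspace_continuousP => x /=; rewrite in_itv /= => /andP[x0 xt].
  have fx := has_deriv_ge0_cvg (f0 _ x0).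
  move=> A /= Afx.
  have : nbhs x (fun s => s != x -> 0 <= s -> A (f s)) by exact: fx _ Afx.
  apply: (@filterS _ (nbhs x)) => s sA.
  rewrite /= in_itv /= => /andP[s0 _]; have [->|sx] := eqVneq s x.
    exact: nbhs_singleton Afx.
  exact: sA.
have [c _] := MVT_segment t0 fd fc.
by rewrite mul0r => /eqP; rewrite subr_eq0 => /eqP.
Qed.

End HalfLineDerivative.

(** * Singular vectors along a path of matrices *)

Section SingularVectors.
Variable R : realType.

Lemma nth_colE m n (A : 'M[R]_(m, n)) (k : 'I_n) : nth_col A k = col k A.
Proof. by rewrite /nth_col valK. Qed.

Lemma nth_col_default m n (A : 'M[R]_(m, n)) k :
  (n <= k)%N -> nth_col A k = 0.
Proof. by move=> nk; rewrite /nth_col insubF // ltnNge nk. Qed.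

Lemma is_svd_trmx m n (A : 'M[R]_(m, n)) U s V :
  is_svd A U s V -> is_svd A^T V s U.
Proof.
case=> UU VV AE sm s0; split=> // [|i]; last by rewrite minnC; exact: s0.
rewrite AE !trmx_mul trmxK mulmxA; congr (_ *m _ *m _).
by apply/matrixP => i j; rewrite !mxE; case: eqVneq => [->|].
Qed.

Lemma svd_ge0 m n (A : 'M[R]_(m, n)) U s V i :
  is_svd A U s V -> 0 <= s i.
Proof. by case=> _ _ _ sm _; have /andP[] := sm i i (leqnn i). Qed.

(** The relation survives for every natural k: if n <= k both sides vanish by the default values,
    and if m <= k < n column k of Sigma and the default [nth_col U k] are both 0. *)
Lemma svd_mul_nth_col m n (A : 'M[R]_(m, n)) U s V k :
  is_svd A U s V -> A *m nth_col V k = s k *: nth_col U k.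
Proof.
case=> UU VV AE sm s0; have [nk|kn] := leqP n k.
  by rewrite nth_col_default // mulmx0 s0 ?scale0r // geq_min nk orbT.
pose j := Ordinal kn; rewrite -[k]/(val j) nth_colE AE colE -!mulmxA.
rewrite (mulmxA V^T) VV mul1mx -colE.
have [mk|km] := leqP m k.
  rewrite nth_col_default // scaler0.
  rewrite (_ : col j _ = 0) ?mulmx0 //; apply/matrixP => a b; rewrite !mxE.
  by rewrite ltn_eqF ?mulr0n //= (leq_trans (ltn_ord a)).
pose i := Ordinal km.
have -> : nth_col U (val j) = col i U by exact: (nth_colE U i).
rewrite [col i U]colE scalemxAr.
congr (_ *m _); apply/matrixP => a b; rewrite !mxE ord1 eqxx andbT.
have -> : (a == j :> nat) = (a == i) by [].
by rewrite mulr_natr; case: eqVneq => [->|].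
Qed.

Lemma nth_col_unit n (U : 'M[R]_n) (k : 'I_n) :
  U^T *m U = 1%:M -> (nth_col U k)^T *m nth_col U k = 1%:M.
Proof.
move=> UU; rewrite nth_colE colE trmx_mul -mulmxA (mulmxA U^T) UU mul1mx.
by rewrite trmx_delta mul_delta_mx; apply/matrixP => i j; rewrite !ord1 !mxE.
Qed.

Lemma dotC m (a b : 'cV[R]_m) : a^T *m b = b^T *m a.
Proof.
apply/matrixP => i j; rewrite !ord1 !mxE.
by apply: eq_bigr => k _; rewrite !mxE mulrC.
Qed.

(** Alignment makes U^T V diagonal with entries 1 or -1, and the sign condition leaves the
    identity. *)
Lemma aligned_eq n (U V : 'M[R]_n) : U^T *m U = 1%:M ->
  (forall k k' : 'I_n,
     `|((nth_col U k)^T *m nth_col V k') 0 0| = (k == k')%:R) ->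
  (forall k : 'I_n, 0 <= ((nth_col U k)^T *m nth_col V k) 0 0) -> V = U.
Proof.
move=> UU al ge0; have UV : U^T *m V = 1%:M.
  apply/matrixP => k k'; rewrite [RHS]mxE.
  have <- : ((nth_col U k)^T *m nth_col V k') 0 0 = (U^T *m V) k k'.
    by rewrite !nth_colE !mxE; apply: eq_bigr => i _; rewrite !mxE.
  have := al k k'; have [<-|kk'] := eqVneq k k'.
    by rewrite ger0_norm.
  by move/eqP; rewrite normr_eq0 => /eqP.
by rewrite -[LHS]mul1mx -(mulmx1C UU) -mulmxA UV mulmx1.
Qed.

Local Notation half t := (within [set s : R | 0 <= s] t^').

Lemma within_continuous_half (E : topologicalType) (f : R -> E) (t : R) :
  0 <= t ->
  {within [set s : R | 0 <= s], continuous f} -> f s @[s --> half t] --> f t.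
Proof.
move=> t0 /subspace_continuousP/(_ t t0) ft A At.
by apply: (@filterS _ (nbhs t) _ _ _ _ (ft A At)) => s sA _.
Qed.

(* Neither u nor v is assumed differentiable: with D = P s - P t,
   (sigma s - sigma t) (<u s, u t> + <v s, v t>)
     = (u s)^T D (v t) + (u t)^T D (v s). *)
Lemma singular_value_deriv m n (P : R -> 'M[R]_(m, n)) dP
    (u : R -> 'cV[R]_m) (v : R -> 'cV[R]_n) (sg : R -> R) (t : R) : 0 <= t ->
  (forall s, 0 <= s -> P s *m v s = sg s *: u s) ->
  (forall s, 0 <= s -> (P s)^T *m u s = sg s *: v s) ->
  u s @[s --> half t] --> u t -> v s @[s --> half t] --> v t ->
  (u t)^T *m u t = 1%:M -> (v t)^T *m v t = 1%:M \/ v t = 0 ->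
  has_deriv_ge0 P t dP -> has_deriv_ge0 sg t (((u t)^T *m dP *m v t) 0 0).
Proof.
move=> t0 Pv Pu cu cv uu vv Pt.
pose D s := ((u s)^T *m u t + (v s)^T *m v t) 0 0.
pose q s := (s - t)^-1 *: (P s - P t).
pose Nm s := ((u s)^T *m q s *m v t + (u t)^T *m q s *m v s) 0 0.
(* D t is 2, or 1 when v t is the default 0. *)
have D_gt0 : 0 < D t.
  rewrite /D uu; case: vv => [->|->]; rewrite ?mulmx0 !mxE eqxx /= ?mulr1n; lra.
have cD : D s @[s --> half t] --> D t.
  apply: (proj1 (cvg_mxP _ _)); apply: cvgD;
    by apply: cvg_mulmx; [exact: cvg_trmx|exact: cvg_cst].
have cN : Nm s @[s --> half t] -->
    ((u t)^T *m dP *m v t + (u t)^T *m dP *m v t) 0 0.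
  apply: (proj1 (cvg_mxP _ _)); apply: cvgD; apply: cvg_mulmx => //.
  - by apply: cvg_mulmx => //; exact: cvg_trmx.
  - exact: cvg_cst.
  - by apply: cvg_mulmx => //; exact: cvg_cst.
have qE s : 0 <= s -> Nm s = (s - t)^-1 * ((sg s - sg t) * D s).
  move=> s0; rewrite /Nm /q /D.
  rewrite -!scalemxAr -!scalemxAl -scalerDr mxE; congr (_ * _).
  have e1 : (u s)^T *m P s = sg s *: (v s)^T.
    by rewrite -[P s]trmxK -trmx_mul Pu // linearZ.
  have e2 : (u t)^T *m P t = sg t *: (v t)^T.
    by rewrite -[P t]trmxK -trmx_mul Pu // linearZ.
  rewrite !mulmxBr !mulmxBl e1 e2 -!mulmxA !Pv // -!scalemxAl -!scalemxAr.
  rewrite (dotC (u t)) (dotC (v t)).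
  move: (_ *m u t) (_ *m v t) => a b; rewrite !mxE; ring.
have : Nm s / D s @[s --> half t] --> ((u t)^T *m dP *m v t) 0 0.
  have -> : ((u t)^T *m dP *m v t) 0 0 =
    ((u t)^T *m dP *m v t + (u t)^T *m dP *m v t) 0 0 / D t.
    rewrite /D uu; case: vv => [->|->]; last by rewrite !mulmx0 addr0 mxE mul0r.
    by move: (_ *m v t) => Z; rewrite !mxE eqxx /= ?mulr1n; field.
  by apply: cvgM => //; apply: cvgV => //; exact: lt0r_neq0.
apply: cvg_trans; apply: near_eq_cvg.
have nD : \forall s \near half t, 0 < D s by exact: (cvgr_gt _ cD).
apply: filterS2 nD (near_half t) => s Ds [st s0] /=.
by rewrite qE // mulrA mulfK // lt0r_neq0.
Qed.

(** Symmetry gives (lam s - lam t) <u s, u t> = 0, and the inner product stays positive for s near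
    t. Hence lam is locally constant and has zero derivative, without any differentiability of u. *)
Lemma eigenvalue_cst m (Q : 'M[R]_m) (u : R -> 'cV[R]_m) (lam : R -> R) :
  Q^T = Q ->
  (forall t, 0 <= t -> Q *m u t = lam t *: u t) ->
  (forall t, 0 <= t -> (u t)^T *m u t = 1%:M) ->
  (forall t : R, 0 <= t -> u s @[s --> half t] --> u t) ->
  forall t, 0 <= t -> lam t = lam 0.
Proof.
move=> symQ Qu uu cu; apply: deriv_ge0_0_cst => t t0.
pose D s := ((u s)^T *m u t) 0 0.
have Dt : D t = 1 by rewrite /D uu // mxE eqxx.
have cD : D s @[s --> half t] --> D t.
  apply: (proj1 (cvg_mxP _ _)).
  by apply: cvg_mulmx; [exact: cvg_trmx (cu _ t0)|exact: cvg_cst].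
have nD : \forall s \near half t, 0 < D s.
  by apply: (cvgr_gt _ cD); rewrite Dt.
have : (0 : R) @[_ --> half t] --> (0 : R) by exact: cvg_cst.
apply: cvg_trans; apply: near_eq_cvg.
apply: filterS2 nD (near_half t) => s Ds [st s0] /=.
have : (u s)^T *m Q *m u t = lam s *: ((u s)^T *m u t).
  by rewrite -{1}symQ -trmx_mul Qu // linearZ /= -scalemxAl.
rewrite -mulmxA Qu // -scalemxAr => /matrixP/(_ 0 0).
rewrite mxE [RHS]mxE => /(mulIf (lt0r_neq0 Ds)) ->.
by rewrite subrr scaler0.
Qed.

End SingularVectors.

(** * Product rule and conservation laws along the gradient flow *)

Section Flow.
Variables (R : realType) (n : nat -> nat).

Lemma has_deriv_layer_prod (W : R -> weights R n) (dW : weights R n) t m :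
  (forall i, (i < m)%N -> has_deriv_ge0 (fun s => W s i) t (dW i)) ->
  has_deriv_ge0 (fun s => layer_prod (W s) m) t
    (\sum_(j < m) tail_prod (W t) j.+1 m *m dW j *m layer_prod (W t) j).
Proof.
elim: m => [|m IH] Wt; first by rewrite big_ord0; exact: has_deriv_ge0_cst.
have dP := IH (fun i im => Wt i (ltnW im)).
have := has_deriv_ge0_mulmx (Wt m (ltnSn m)) dP.
congr has_deriv_ge0; rewrite big_ord_recr /= [RHS]addrC.
rewrite eqxx conform_mx_id mul1mx mulmx_sumr; congr (_ + _).
apply: eq_bigr => j _; rewrite !mulmxA.
by have := ltn_ord j; rewrite -ltnS => /ltn_eqF ->.
Qed.

Variables (L N : nat).
Variables (X : 'I_N -> 'cV[R]_(n 0%N)) (lab : 'I_N -> 'I_(n L.+1)).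
Variable W : R -> weights R n.
Hypothesis hflow : forall (t : R) (i : nat), 0 <= t -> (i <= L)%N ->
  has_deriv_ge0 (fun s : R => W s i) t (- grad X lab (W t) i).

(** By the chain rule formula both sides are the same product: the transposed tail from layer j+1,
    [output_grad], and the transposed product of the layers up to j. *)
Lemma grad_balance (Wt : weights R n) j : (j < L)%N ->
  (Wt j.+1)^T *m grad X lab Wt j.+1 = grad X lab Wt j *m (Wt j)^T.
Proof.
move=> jL; rewrite !gradE ?(ltnW jL) // (@tail_prod_recr _ _ Wt j.+1) ?ltnS //.
by rewrite /= !trmx_mul !mulmxA.
Qed.

(** The four terms of the derivative cancel in pairs by [grad_balance] and its transpose. The range
    of j includes the pair formed by the last hidden layer and the output layer. *)
Lemma gram_diff_cst j t : (j < L)%N -> 0 <= t ->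
  (W t j.+1)^T *m W t j.+1 - W t j *m (W t j)^T =
  (W 0 j.+1)^T *m W 0 j.+1 - W 0 j *m (W 0 j)^T.
Proof.
move=> jL; move: t.
pose Q s := (W s j.+1)^T *m W s j.+1 - W s j *m (W s j)^T.
have dQ s : 0 <= s -> has_deriv_ge0 Q s 0.
  move=> s0.
  have d1 := hflow s0 jL; have d0 := hflow s0 (ltnW jL).
  have := has_deriv_ge0B
    (has_deriv_ge0_mulmx (has_deriv_ge0_trmx d1) d1)
    (has_deriv_ge0_mulmx d0 (has_deriv_ge0_trmx d0)).
  rewrite !linearN /= !mulNmx ?mulmxN grad_balance //.
  rewrite -[X in - X - _ - _](trmxK) trmx_mul trmxK grad_balance //.
  by rewrite trmx_mul trmxK [X in X - _]addrC subrr.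
move=> t t0; apply/matrixP => a b.
apply: (@deriv_ge0_0_cst _ (fun s => Q s a b)) t0 => s s0.
by have := has_deriv_ge0_entry (i := a) (j := b) (dQ s s0); rewrite mxE.
Qed.

End Flow.

(** * Fractional exponents and Gram eigenvectors at a fixed time *)

Lemma powR_root_expr (R : realType) (x : R) (L : nat) : 0 <= x ->
  (x `^ (2 / L.+1%:R)) ^+ L.+1 = x ^+ 2.
Proof.
move=> x0; rewrite -!powR_mulrn ?powR_ge0 // -powRrM divfK //.
Qed.

Lemma powR_root_expr_pred (R : realType) (x : R) (L : nat) :
  x `^ (2 - 2 / L.+1%:R) = (x `^ (2 / L.+1%:R)) ^+ L.
Proof.
rewrite -powR_mulrn ?powR_ge0 // -powRrM; congr (_ `^ _).
have : (L.+1%:R : R) != 0 by rewrite pnatr_eq0.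
by rewrite -natr1 => L0; field; rewrite natr1 pnatr_eq0.
Qed.

Section FixedTime.
Variables (R : realType) (n : nat -> nat) (L : nat) (W : weights R n).
Variables (U : 'M[R]_(n L.+1)) (s : nat -> R) (V : 'M[R]_(n 0%N)).
Hypothesis svdP : is_svd (layer_prod W L.+1) U s V.
Hypothesis bal : forall i, (i.+1 < L.+1)%N ->
  (W i.+1)^T *m W i.+1 = W i *m (W i)^T.
Variable k : 'I_(n L.+1).
Let u := nth_col U k.
Let v := nth_col V k.
Let r := s k `^ (2 / L.+1%:R).

Lemma last_gram_eigen : W L *m (W L)^T *m u = r *: u.
Proof.
apply: (@gram_pow_eigen _ _ _ _ _ _ L); first exact: powR_ge0.
have := tail_prod_gram bal (ltnSn L) (leq0n L.+1); rewrite subn0 => <-.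
have := layer_prod_tail W (leq0n L.+1); rewrite mulmx1 => <-.
rewrite powR_root_expr ?(svd_ge0 k svdP) // -mulmxA.
rewrite (svd_mul_nth_col k (is_svd_trmx svdP)) -scalemxAr.
by rewrite (svd_mul_nth_col k svdP) scalerA.
Qed.

Lemma first_gram_eigen : (W 0%N)^T *m W 0%N *m v = r *: v.
Proof.
(* The double transpose puts the matrix in the form B B^T with B = W_0^T. *)
rewrite -[X in _ *m X *m v]trmxK.
apply: (@gram_pow_eigen _ _ _ _ _ _ L); first exact: powR_ge0.
rewrite trmxK -(layer_prod_gram bal (leqnn L.+1)).
rewrite powR_root_expr ?(svd_ge0 k svdP) // -mulmxA.
rewrite (svd_mul_nth_col k svdP) -scalemxAr.
by rewrite (svd_mul_nth_col k (is_svd_trmx svdP)) scalerA.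
Qed.

(** The power r^(L-j) found here and r^j from [layer_gram_eigen] multiply to r^L for every j, so all
    layers contribute equally. *)
Lemma tail_gram_eigen j : (j < L.+1)%N ->
  u^T *m tail_prod W j.+1 L.+1 *m (tail_prod W j.+1 L.+1)^T
  = r ^+ (L - j) *: u^T.
Proof.
move=> jL; rewrite -mulmxA (tail_prod_gram bal (ltnSn L)) // subSS.
apply: trmx_inj; rewrite trmx_mul trmxK trmx_exp trmx_mul trmxK.
by rewrite (eigen_pow _ last_gram_eigen) linearZ /= trmxK.
Qed.

Lemma layer_gram_eigen j : (j <= L.+1)%N ->
  (layer_prod W j)^T *m layer_prod W j *m v = r ^+ j *: v.
Proof.
by move=> jL; rewrite (layer_prod_gram bal jL) (eigen_pow _ first_gram_eigen).
Qed.

End FixedTime.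

(** * Evolution of the singular values of the hidden product *)

Theorem theorem1 (R : realType) (L : nat) (hL : (1 <= L)%N)
  (n : nat -> nat) (N : nat)
  (X : 'I_N -> 'cV[R]_(n 0%N)) (lab : 'I_N -> 'I_(n L.+1))
  (W : R -> weights R n)
  (* gradient flow on [0, +oo[ *)
  (hflow : forall (t : R) (i : nat), 0 <= t -> (i <= L)%N ->
     has_deriv_ge0 (fun s : R => W s i) t (- grad X lab (W t) i))
  (* singular value decompositions of Pi(t) and of the last layer *)
  (U : R -> 'M[R]_(n L)) (sigma : R -> nat -> R) (V : R -> 'M[R]_(n 0%N))
  (hsvd : forall t : R, 0 <= t ->
     is_svd (layer_prod (W t) L) (U t) (sigma t) (V t))
  (Ulast : R -> 'M[R]_(n L.+1)) (slast : R -> nat -> R)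
  (Vlast : R -> 'M[R]_(n L))
  (hsvd_last : forall t : R, 0 <= t ->
     is_svd (W t L) (Ulast t) (slast t) (Vlast t))
  (* the singular vectors of Pi(t) are chosen continuously in time *)
  (hU : forall k : 'I_(n L),
     {within [set t : R | 0 <= t], continuous (fun t : R => nth_col (U t) k)})
  (hV : forall k : 'I_(n L),
     {within [set t : R | 0 <= t], continuous (fun t : R => nth_col (V t) k)})
  (* assumption (1) *)
  (hbal : forall i : nat, (i.+1 < L)%N ->
     (W 0 i.+1)^T *m W 0 i.+1 = W 0 i *m (W 0 i)^T)
  (* assumption (2) *)
  (halign : forall (t : R) (k k' : 'I_(n L)), 0 <= t ->
     `|((nth_col (U t) k)^T *m nth_col (Vlast t) k') 0 0| = (k == k')%:R)
  (* sign convention for the singular pairs of the last layer *)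
  (horient : forall (t : R) (k : 'I_(n L)), 0 <= t ->
     0 <= ((nth_col (U t) k)^T *m nth_col (Vlast t) k) 0 0) :
  forall k : 'I_(n L), exists M : R, forall t : R, 0 <= t ->
    within_class_cov X lab (W t) = 0 ->
    has_deriv_ge0 (fun s : R => sigma s k) t
      (N%:R * L%:R * (sigma t k `^ (2 - 2 / L%:R))
       * Num.sqrt (sigma t k `^ (2 / L%:R) + M)
       * ((nth_col (Ulast t) k)^T *m Gmat X lab (W t)
            *m nth_col (V t) k) 0 0).
Proof.
(* From here on there are [L.+1] hidden layers and the output layer is [W t L.+1]. *)
destruct L as [|L] => // k.
pose r t := sigma t k `^ (2 / L.+1%:R).
pose lam t := slast t k ^+ 2 - r t.
have bal t i : 0 <= t -> (i.+1 < L.+1)%N ->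
    (W t i.+1)^T *m W t i.+1 = W t i *m (W t i)^T.
  move=> t0 iL; apply/eqP; rewrite -subr_eq0.
  by rewrite (gram_diff_cst hflow (ltnW iL) t0) hbal // subrr.
have VU t : 0 <= t -> Vlast t = U t.
  move=> t0; apply: aligned_eq => [|i j|i].
  - by case: (hsvd t t0).
  - exact: halign.
  - exact: horient.
have lastV t : 0 <= t -> W t L.+1 *m nth_col (U t) k
    = slast t k *: nth_col (Ulast t) k.
  by move=> t0; rewrite -VU // (svd_mul_nth_col k (hsvd_last _ t0)).
have lamE t : 0 <= t -> lam t = lam 0.
  apply: (@eigenvalue_cst _ _
    ((W 0 L.+1)^T *m W 0 L.+1 - W 0 L *m (W 0 L)^T) (fun t => nth_col (U t) k)).
  - by rewrite linearB /= !trmx_mul !trmxK.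
  - move=> s s0; rewrite -(gram_diff_cst hflow (ltnSn L) s0) mulmxBl.
    rewrite (last_gram_eigen (hsvd _ s0) (bal s ^~ s0)) -mulmxA lastV //.
    rewrite -scalemxAr (svd_mul_nth_col k (is_svd_trmx (hsvd_last _ s0))).
    by rewrite scalerA VU // -scalerBl.
  - by move=> s s0; apply: nth_col_unit; case: (hsvd s s0).
  - by move=> s s0; apply: (within_continuous_half s0 (hU k)).
(* The constant is s_k(0)^2 - sigma_k(0)^(2/L), with L the original number of hidden layers; it
   depends on k. *)
exists (lam 0) => t t0 cov0.
have slE : Num.sqrt (r t + lam 0) = slast t k.
  rewrite -(lamE _ t0) /lam addrC subrK sqrtr_sqr ger0_norm //.
  exact: svd_ge0 k (hsvd_last _ t0).
set u := nth_col (U t) k; set v := nth_col (V t) k.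
set w := nth_col (Ulast t) k; set G := Gmat X lab (W t).
pose T j := tail_prod (W t) j.+1 L.+1; pose B j := layer_prod (W t) j.
(* When k >= d_in, v_k is the default 0 rather than a unit vector. *)
have vv : v^T *m v = 1%:M \/ v = 0.
  have [kn|nk] := ltnP k (n 0%N).
    by left; apply: (@nth_col_unit _ _ _ (Ordinal kn)); case: (hsvd t t0).
  by right; rewrite /v nth_col_default.
have dP := has_deriv_layer_prod (fun i iL => hflow t i t0 (ltnW iL)).
have := singular_value_deriv t0
  (fun s s0 => svd_mul_nth_col k (hsvd s s0))
  (fun s s0 => svd_mul_nth_col k (is_svd_trmx (hsvd s s0)))
  (within_continuous_half t0 (hU k)) (within_continuous_half t0 (hV k))
  (nth_col_unit k (let: And5 UU _ _ _ _ := hsvd t t0 in UU)) vv dP.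
congr has_deriv_ge0.
(* Vanishing covariance reduces [output_grad] to -N G, whose sign cancels that of the flow. *)
have gradN j : (j < L.+1)%N ->
    - grad X lab (W t) j = N%:R *: ((T j)^T *m (W t L.+1)^T *m G *m (B j)^T).
  move=> jL; rewrite gradE 1?ltnW // output_gradE cov0 sub0r tail_prodS //.
  by rewrite trmx_mul mulmxN mulNmx opprK -scalemxAr -scalemxAl.
have term (j : 'I_L.+1) :
    u^T *m (T j *m - grad X lab (W t) j *m B j) *m v
    = (N%:R * (sigma t k `^ (2 - 2 / L.+1%:R)) * slast t k)
        *: (w^T *m G *m v).
  have uT := tail_gram_eigen (hsvd _ t0) (bal t ^~ t0) k (ltn_ord j).
  have Bv := layer_gram_eigen (hsvd _ t0) (bal t ^~ t0) k (ltnW (ltn_ord j)).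
  have uW : u^T *m (W t L.+1)^T = slast t k *: w^T.
    by rewrite -trmx_mul lastV // linearZ.
  rewrite gradN // -scalemxAr -scalemxAl -scalemxAr -scalemxAl !mulmxA.
  rewrite uT -!scalemxAl uW -!scalemxAl -!(mulmxA (w^T *m G)) Bv.
  rewrite -!scalemxAr !scalerA powR_root_expr_pred; congr (_ *: _).
  have -> : (sigma t k `^ (2 / L.+1%:R)) ^+ L
      = (sigma t k `^ (2 / L.+1%:R)) ^+ (L - j)
        * (sigma t k `^ (2 / L.+1%:R)) ^+ j.
    by rewrite -exprD subnK // -ltnS.
  ring.
rewrite mulmx_sumr mulmx_suml (eq_bigr _ (fun j _ => term j)).
rewrite sumr_const card_ord -/(r t) slE -scaler_nat scalerA mxE.
ring.
Qed.
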